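(* There is a temporally connected temporal cycle $\mathcal{C}$ such that there is no Nash equilibrium in the two-player temporal diffusion game $\mathrm{Diff}(\mathcal{C},2)$.
   Context: A temporal graph $\mathcal{G}=(V,(E_t)_{t=1}^\infty)$ consists of a finite vertex set $V$ and edge sets $E_t\subseteq\binom{V}{2}$; its $t$-th layer is $G_t=(V,E_t)$. It is assumed to have finite lifetime, i.e. there is $\tau$ with $E_t=E_\tau$ for all $t\ge\tau$. The underlying graph is $(V,\bigcup_t E_t)$. A temporal cycle is a temporal graph whose underlying graph is a cycle. A temporal walk from $v_0$ to $v_d$ is a sequence $(\{v_0,v_1\},t_1),\dots,(\{v_{d-1},v_d\},t_d)$ with $t_1<t_2<\dots<t_d$ and $\{v_{i-1},v_i\}\in E_{t_i}$ for all $i$. $\mathcal{G}$ is temporally connected if for all distinct $u,v\in V$ there is a temporal walk from $u$ to $v$. Two-player temporal diffusion game $\mathrm{Diff}(\mathcal{G},2)$: players $1,2$ choose vertices $p_1,p_2\in V$ simultaneously. At time $0$, if $p_1\ne p_2$ then $p_i$ gets color $i$; if $p_1=p_2$ this vertex is colored gray. For $t=1,2,\dots$, in step $t$ each uncolored vertex having a neighbor in $G_t$ of color $i\in\{1,2\}$ and no neighbor in $G_t$ of the other player's color gets color $i$; each uncolored vertex having neighbors in $G_t$ of both colors $1$ and $2$ becomes gray. Gray does not spread, and colors never change. The payoff of player $i$ is the final number of vertices of color $i$. A profile $(p_1,p_2)$ is a Nash equilibrium if no player can strictly increase her payoff by unilaterally choosing another vertex. *)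

(* Defs.v *)
From HB Require Import structures.
From mathcomp Require Import all_boot.
From mathcomp Require Import boolp.

Set Implicit Arguments.
Unset Strict Implicit.
Unset Printing Implicit Defensive.

(* Layers are indexed by t >= 1; the value [edges 0] is never used. *)
Record temporal_graph (V : finType) := TemporalGraph {
  edges : nat -> {set {set V}};
  edges_card2 : forall t e, 0 < t -> e \in edges t -> #|e| = 2;
  finite_lifetime :
    exists2 tau, 0 < tau & forall t, tau <= t -> edges t = edges tau }.

Definition underlying_edge (V : finType) (G : temporal_graph V) (e : {set V}) :
    Prop :=
  exists2 t, 0 < t & e \in edges G t.

Definition is_cycle_graph (V : finType) (E : {set V} -> Prop) : Prop :=
  exists c : seq V,
    [/\ uniq c, 3 <= size c, forall v, v \in c &
        forall e, E e <-> exists v, e = [set v; next c v]].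

Definition temporal_cycle (V : finType) (G : temporal_graph V) : Prop :=
  is_cycle_graph (underlying_edge G).

(* A walk ({v_0, v_1}, t_1), ..., ({v_(d-1), v_d}, t_d) is encoded by v_0 and
   the list (v_1, t_1), ..., (v_d, t_d). Starting the path at (v_0, 0) imposes
   t_1 >= 1. *)
Definition temporal_walk (V : finType) (G : temporal_graph V) (u v : V)
    (w : seq (V * nat)) : Prop :=
  path (fun a b => (a.2 < b.2) && ([set a.1; b.1] \in edges G b.2)) (u, 0) w
  /\ (last (u, 0) w).1 = v.

Definition temporally_connected (V : finType) (G : temporal_graph V) : Prop :=
  forall u v : V, u != v -> exists w, temporal_walk G u v w.

Variant color := Uncolored | Color1 | Color2 | Gray.

Definition nat_of_color (c : color) : nat :=
  match c with Uncolored => 0 | Color1 => 1 | Color2 => 2 | Gray => 3 end.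

Definition color_of_nat (n : nat) : color :=
  match n with 0 => Uncolored | 1 => Color1 | 2 => Color2 | _ => Gray end.

Lemma nat_of_colorK : cancel nat_of_color color_of_nat.
Proof. by case. Qed.

HB.instance Definition _ := Equality.copy color (can_type nat_of_colorK).

Definition initial_coloring (V : finType) (p1 p2 v : V) : color :=
  if p1 == p2 then (if v == p1 then Gray else Uncolored)
  else if v == p1 then Color1
  else if v == p2 then Color2
  else Uncolored.

Definition has_neighbor (V : finType) (E : {set {set V}}) (f : V -> color)
    (c : color) (v : V) : bool :=
  [exists u, ([set u; v] \in E) && (f u == c)].

Definition diffusion_step (V : finType) (E : {set {set V}}) (f : V -> color)
    (v : V) : color :=
  if f v != Uncolored then f v
  else match has_neighbor E f Color1 v, has_neighbor E f Color2 v with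
       | true, true => Gray
       | true, false => Color1
       | false, true => Color2
       | false, false => Uncolored
       end.

Fixpoint coloring (V : finType) (G : temporal_graph V) (p1 p2 : V) (t : nat) :
    V -> color :=
  match t with
  | 0 => initial_coloring p1 p2
  | t'.+1 => diffusion_step (edges G t) (coloring G p1 p2 t')
  end.

(* Colors never change, so the final color of v is c (for c != Uncolored)
   exactly when v has color c after some step. *)
Definition payoff (V : finType) (G : temporal_graph V) (c : color)
    (p1 p2 : V) : nat :=
  #|[set v | `[< exists t, coloring G p1 p2 t v = c >]]|.

Definition nash_equilibrium (V : finType) (G : temporal_graph V)
    (p1 p2 : V) : Prop :=
  (forall q, payoff G Color1 q p2 <= payoff G Color1 p1 p2) /\
  (forall q, payoff G Color2 p1 q <= payoff G Color2 p1 p2).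

(* Main.v *)
(** A computer search over small temporal cycles finds one on the vertices
    0, ..., 4: the layers have edges {12, 23}, then {01, 12}, then
    {01, 12, 34, 40} forever. The last layer is a spanning path, which gives
    temporal connectedness, and each of the 25 diffusions is stationary after
    seven steps, so that for every profile a profitable deviation is found by
    evaluation. *)

Require Import Defs.
From mathcomp Require Import all_boot.
From mathcomp Require Import boolp.

Set Implicit Arguments.
Unset Strict Implicit.
Unset Printing Implicit Defensive.

Lemma eq_set2 (T : finType) (a b x y : T) : a != b ->
  ([set x; y] == [set a; b]) = (x == a) && (y == b) || (x == b) && (y == a).
Proof.
move=> ab; apply/eqP/orP => [E|[|] /andP[/eqP-> /eqP->]] //; last exact: setUC.
have := set21 x y; have := set22 x y; rewrite E !inE.
have := set21 a b; have := set22 a b; rewrite -E !inE.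
do 4 case/orP=> /eqP ?; subst; rewrite ?eqxx ?orbT //=; auto;
  by rewrite eqxx in ab.
Qed.

(** This links payoffs, which are cardinalities over ordinals, to a [count] on a list that can be
    evaluated. *)
Lemma card_nth_eq (T : eqType) (x0 c : T) n (s : seq T) :
  size s = n -> #|[set v : 'I_n | nth x0 s v == c]| = count (pred1 c) s.
Proof.
move=> <-; rewrite -[in RHS](mkseq_nth x0 s) /mkseq -val_enum_ord !count_map.
rewrite cardsE cardE -size_filter /enum_mem -enumT.
by congr size; apply: eq_filter.
Qed.

Lemma coloring_persist (V : finType) (G : temporal_graph V) (p1 p2 : V) s t v :
  s <= t -> coloring G p1 p2 s v != Uncolored ->
  coloring G p1 p2 t v = coloring G p1 p2 s v.
Proof.
move=> /subnK <-; elim: (t - s) => //= d IHd colored.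
by rewrite /diffusion_step IHd // colored.
Qed.

(** Every step after [T] uses the same layer, so once one such step changes nothing, none of the
    later ones does. *)
Lemma coloring_stable (V : finType) (G : temporal_graph V) (p1 p2 : V) T t :
  (forall t, T < t -> edges G t = edges G T.+1) ->
  coloring G p1 p2 T.+1 = coloring G p1 p2 T -> T <= t ->
  coloring G p1 p2 t = coloring G p1 p2 T.
Proof.
move=> late fixT /subnK <-; elim: (t - T) => //= d ->.
by rewrite late ?ltnS ?leq_addl.
Qed.

(** A vertex colored before [T] keeps its color up to [T], and nothing changes after [T]; so the
    coloring at [T] decides the payoff. *)
Lemma payoff_stable (V : finType) (G : temporal_graph V) (c : color)
    (p1 p2 : V) T :
  c != Uncolored -> (forall t, T < t -> edges G t = edges G T.+1) ->
  coloring G p1 p2 T.+1 = coloring G p1 p2 T ->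
  payoff G c p1 p2 = #|[set v | coloring G p1 p2 T v == c]|.
Proof.
move=> c_color late fixT; congr #|pred_of_set _|; apply/setP => v; rewrite !inE.
apply/asboolP/eqP => [[t Et]|]; last by exists T.
case: (leqP T t) => [leTt|/ltnW letT]; first by rewrite -(coloring_stable late fixT leTt).
by rewrite (coloring_persist letT) Et.
Qed.

(** Once the layers are constantly [E], a static path in [E] can be followed one edge per time
    step. *)
Lemma temporal_walk_stable (V : finType) (G : temporal_graph V)
    (E : {set {set V}}) T (u v : V) :
  (forall t, T < t -> edges G t = E) ->
  connect (fun a b => [set a; b] \in E) u v -> exists w, temporal_walk G u v w.
Proof.
move=> late /connectP[p pathp ->] {v}.
have walk s : T <= s -> exists w,
    path (fun a b => (a.2 < b.2) && ([set a.1; b.1] \in edges G b.2)) (u, s) w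
    /\ (last (u, s) w).1 = last u p.
  elim: p u s pathp => [|x p IHp] u s /=; first by exists [::].
  case/andP=> ux /IHp IHx leTs; have [w [pathw lastw]] := IHx s.+1 (leqW leTs).
  by exists ((x, s.+1) :: w); rewrite /= ltnSn late ?ux.
(* The walk found starts at time [T] instead of [0]; this affects only the first time comparison. *)
have [[|[x t] w] [/= pathw lastw]] := walk T (leqnn T); first by exists [::].
exists ((x, t) :: w); split=> //=.
by case/andP: pathw => /andP[/(leq_ltn_trans (leq0n T)) -> ->].
Qed.

(* The number [i] stands for the edge {i, i+1 mod 5}. *)
Definition layer (t : nat) : seq nat :=
  match t with
  | 1 => [:: 1; 2]
  | 2 => [:: 0; 1]
  | _ => [:: 0; 1; 3; 4]
  end.

Definition layer_edges (t : nat) : {set {set 'I_5}} :=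
  [set e | [exists i : 'I_5, (val i \in layer t) && (e == [set i; ordS i])]].

Lemma ordS5_neq (i : 'I_5) : i != ordS i.
Proof. by case: i => -[|[|[|[|[|]]]]]. Qed.

Lemma layer_edges_card2 t (e : {set 'I_5}) :
  0 < t -> e \in layer_edges t -> #|e| = 2.
Proof.
by rewrite inE => _ /existsP[i /andP[_ /eqP->]]; rewrite cards2 ordS5_neq.
Qed.

Lemma layer_late t : 2 < t -> layer t = layer 3.
Proof. by case: t => [|[|[|]]]. Qed.

Lemma layer_edges_late t : 2 < t -> layer_edges t = layer_edges 3.
Proof. by rewrite /layer_edges => /layer_late ->. Qed.

Lemma layer_edges_lifetime :
  exists2 tau, 0 < tau & forall t, tau <= t -> layer_edges t = layer_edges tau.
Proof. by exists 3 => // t /layer_edges_late. Qed.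

Definition C5 : temporal_graph 'I_5 :=
  TemporalGraph layer_edges_card2 layer_edges_lifetime.

Lemma C5_cycle : temporal_cycle C5.
Proof.
(* The cyclic order 0, 1, 2, 3, 4, in which [next c] agrees with [ordS]. *)
pose c := traject (@ordS 5) ord0 5.
have c_all v : v \in c by case: v => -[|[|[|[|[|]]]]].
exists c; split=> // e; split=> [[t _]|[v ->]].
  rewrite inE => /existsP[i /andP[_ /eqP->]]; exists i.
  by have /eqP <- := next_cycle (isT : fcycle (@ordS 5) c) (c_all i).
have /eqP <- := next_cycle (isT : fcycle (@ordS 5) c) (c_all v).
have [t t_gt0 vt] : exists2 t, 0 < t & val v \in layer t.
  (* The late layers lack only the edge {2, 3}, which occurs in layer 1. *)
  have [v3|] := boolP (val v \in layer 3); first by exists 3.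
  by case: v => -[|[|[|[|[|]]]]] //; exists 1.
by exists t => //; rewrite inE; apply/existsP; exists v; rewrite vt /=.
Qed.

Definition adjacent (es : seq nat) (u v : nat) : bool :=
  (u \in es) && (v == u.+1 %% 5) || (v \in es) && (u == v.+1 %% 5).

Lemma mem_layer_edges t (u v : 'I_5) :
  ([set u; v] \in layer_edges t) = adjacent (layer t) u v.
Proof.
rewrite inE; apply/existsP/idP => [[i]|].
  rewrite eq_set2 ?ordS5_neq // => /andP[it /orP[|]] /andP[/eqP-> /eqP->];
    by rewrite /adjacent it eqxx ?orbT.
case/orP=> /andP[it E]; [exists u | exists v]; rewrite it eq_set2 ?ordS5_neq //.
  by rewrite eqxx -val_eqE /= E.
by rewrite eqxx -!val_eqE /= E orbT.
Qed.

Lemma C5_connected : temporally_connected C5.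
Proof.
move=> u v _; apply: (@temporal_walk_stable _ C5 _ 2 _ _ layer_edges_late).
set r := (fun _ _ => _).
have r_sym : connect_sym r.
  by apply: sym_connect_sym => x y; rewrite /r setUC.
(* The late layers form the spanning path 2, 1, 0, 4, 3, so all vertices are reachable from its end
   2. *)
pose x0 : 'I_5 := inord 2.
pose p : seq 'I_5 := [:: inord 1; inord 0; inord 4; inord 3].
have p_path : path r x0 p by rewrite /= /r !mem_layer_edges !inordK.
have x0_all x : connect r x0 x.
  apply: (path_connect p_path); rewrite !inE -!val_eqE /= !inordK //=.
  by case: x => -[|[|[|[|[|]]]]].
by apply: (connect_trans (y := x0)) => //; rewrite r_sym.
Qed.

(* The values of [coloring C5 p1 p2 t], computed without the opaque
   quantification over finite types, so that they can be evaluated. *)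
Fixpoint state (p1 p2 t : nat) : seq color :=
  match t with
  | 0 => mkseq (fun v =>
      if p1 == p2 then if v == p1 then Gray else Uncolored
      else if v == p1 then Color1
      else if v == p2 then Color2 else Uncolored) 5
  | t'.+1 => let s := state p1 p2 t' in
      let nbr c v := has (fun u => adjacent (layer t) u v &&
                                   (nth Uncolored s u == c)) (iota 0 5) in
      mkseq (fun v =>
        if nth Uncolored s v != Uncolored then nth Uncolored s v
        else match nbr Color1 v, nbr Color2 v with
             | true, true => Gray
             | true, false => Color1
             | false, true => Color2
             | false, false => Uncolored
             end) 5
  end.

Lemma size_state p1 p2 t : size (state p1 p2 t) = 5.
Proof. by case: t => *; rewrite size_mkseq. Qed.

Lemma coloring_state (p1 p2 : 'I_5) t v :
  coloring C5 p1 p2 t v = nth Uncolored (state p1 p2 t) v.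
Proof.
elim: t v => [|t IHt] v; first by rewrite nth_mkseq.
rewrite nth_mkseq //= /diffusion_step IHt.
have nbrE c : has_neighbor (layer_edges t.+1) (coloring C5 p1 p2 t) c v =
    has (fun u => adjacent (layer t.+1) u v &&
                  (nth Uncolored (state p1 p2 t) u == c)) (iota 0 5).
  apply/existsP/hasP => [[u]|[u]].
    by rewrite mem_layer_edges IHt; exists (val u); rewrite // mem_iota /=.
  rewrite mem_iota /= => u5 uP.
  by exists (Ordinal u5); rewrite mem_layer_edges IHt.
by rewrite !nbrE.
Qed.

(** Applied once per player, it reduces a claim about all profiles to a boolean test on numbers,
    decided by [vm_compute]. *)
Lemma all_ord5 (P : nat -> bool) (i : 'I_5) : all P (iota 0 5) -> P i.
Proof. by move/allP; apply; rewrite mem_iota /=. Qed.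

Lemma state_stable (p1 p2 : 'I_5) : state p1 p2 8 = state p1 p2 7.
Proof.
apply/eqP; pose P a b := state a b 8 == state a b 7; rewrite -[_ == _]/(P p1 p2).
have: all (fun a => all (P a) (iota 0 5)) (iota 0 5) by vm_compute.
by move/(all_ord5 p1)/(all_ord5 p2).
Qed.

Definition score (c : color) (p1 p2 : nat) : nat :=
  count (pred1 c) (state p1 p2 7).

Lemma payoff_score (c : color) (p1 p2 : 'I_5) :
  c != Uncolored -> payoff C5 c p1 p2 = score c p1 p2.
Proof.
(* At time 7 the layers are already constant, and step 8 changes no coloring by [state_stable]. *)
move=> c_color; rewrite (payoff_stable (T := 7) c_color).
- rewrite /score -(card_nth_eq Uncolored c (size_state p1 p2 7)).
  by apply: eq_card => v; rewrite !inE coloring_state.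
- move=> t lt7t; rewrite [LHS]layer_edges_late ?[RHS]layer_edges_late //.
  exact: ltn_trans lt7t.
- by apply: funext => v; rewrite !coloring_state state_stable.
Qed.

Lemma profitable_deviation (p1 p2 : 'I_5) : exists q : 'I_5,
  (score Color1 p1 p2 < score Color1 q p2) ||
  (score Color2 p1 p2 < score Color2 p1 q).
Proof.
pose P a b := has (fun q => (score Color1 a b < score Color1 q b) ||
                            (score Color2 a b < score Color2 a q)) (iota 0 5).
have: all (fun a => all (P a) (iota 0 5)) (iota 0 5) by vm_compute.
move=> /(all_ord5 p1)/(all_ord5 p2)/hasP[q]; rewrite mem_iota => q5 better.
by exists (Ordinal q5).
Qed.

Theorem theorem5 :
  exists (V : finType) (G : temporal_graph V),
    [/\ temporal_cycle G,
        temporally_connected G &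
        ~ exists p1 p2 : V, nash_equilibrium G p1 p2].
Proof.
exists 'I_5, C5; split; [exact: C5_cycle | exact: C5_connected |].
case=> p1 [p2 [best1 best2]]; have [q] := profitable_deviation p1 p2.
(* Read as payoffs, each of the two possible improvements contradicts the equilibrium condition of
   its player. *)
by rewrite -!payoff_score // ltnNge best1 ltnNge best2.
Qed.
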